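(* For every semiring $S$, the semisubtractive space $\mathcal{I}_s(S)$ is $T_0$.
   Context: A semiring $S$ means a commutative semiring with multiplicative identity $1$, with $0\neq 1$. An ideal of $S$ is an additive submonoid $\mathfrak{a}$ of $S$ with $sx\in\mathfrak{a}$ for all $s\in S$, $x\in\mathfrak{a}$. $\mathcal{V}(S)$ denotes the set of elements $x\in S$ having an additive inverse $-x$ in $S$. An ideal $\mathfrak{a}$ is semisubtractive if $x\in\mathfrak{a}\cap\mathcal{V}(S)$ implies $-x\in\mathfrak{a}\cap\mathcal{V}(S)$; $\mathcal{I}_s(S)$ is the set of semisubtractive ideals of $S$. The semisubtractive space $\mathcal{I}_s(S)$ is this set with the topology having as subbasic closed sets the sets $\mathcal{H}(\mathfrak{a}):=\{\mathfrak{b}\in\mathcal{I}_s(S)\mid\mathfrak{b}\supseteq\mathfrak{a}\}$, $\mathfrak{a}\in\mathcal{I}_s(S)$. *)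

(* Defs.v *)
From HB Require Import structures.
From mathcomp Require Import all_boot all_algebra.
From mathcomp Require Import boolp classical_sets filter topology_structure.

Set Implicit Arguments.
Unset Strict Implicit.
Unset Printing Implicit Defensive.
Import GRing.Theory.
Local Open Scope classical_set_scope.
Local Open Scope ring_scope.

Definition ideal (S : comNzSemiRingType) (a : set S) : Prop :=
  [/\ a 0, forall x y : S, a x -> a y -> a (x + y)
    & forall s x : S, a x -> a (s * x)].

(* The elements having an additive inverse. *)
Definition Vset (S : comNzSemiRingType) : set S :=
  [set x | exists y, x + y = 0].

(* A semiring has no opposite operation; additive inverses are unique when
   they exist, so [y] with [x + y = 0] stands for -x. *)
Definition semisubtractive (S : comNzSemiRingType) (a : set S) : Prop :=
  forall x y : S, (a `&` @Vset S) x -> x + y = 0 -> (a `&` @Vset S) y.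

Record semisub_ideal (S : comNzSemiRingType) := SemisubIdeal {
  semisub_ideal_set :> set S;
  semisub_ideal_ideal : ideal semisub_ideal_set;
  semisub_ideal_semisubtractive : semisubtractive semisub_ideal_set
}.

HB.instance Definition _ (S : comNzSemiRingType) := gen_eqMixin (semisub_ideal S).
HB.instance Definition _ (S : comNzSemiRingType) :=
  gen_choiceMixin (semisub_ideal S).

Definition hull (S : comNzSemiRingType) (a : semisub_ideal S) :
    set (semisub_ideal S) :=
  [set b : semisub_ideal S | (a : set S) `<=` b].

(* The sets [hull a] form a closed subbase, i.e. their complements form an
   open subbase; the family is indexed by itself. *)
HB.instance Definition _ (S : comNzSemiRingType) :=
  isSubBaseTopological.Build (semisub_ideal S)
    [set ~` hull a | a in [set: semisub_ideal S]] id.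

(* Main.v *)
Require Import Defs.
From mathcomp Require Import all_boot all_algebra.
From mathcomp Require Import boolp classical_sets filter topology_structure
  separation_axioms.

(** Two distinct points [a] and [b] cannot both contain the other, since ideals
    with the same elements are equal.  If [a] is not contained in [b], then [b]
    lies in the complement of [hull a], which is subbasic open and misses [a];
    the case where [b] is not contained in [a] is symmetric.  Hence T0 follows
    from [open_hullC] and the antisymmetry of inclusion
    ([semisub_ideal_anti]). *)

Local Open Scope classical_set_scope.

(** The record proofs are irrelevant, so an ideal is determined by its
    elements. *)
Lemma semisub_ideal_anti (S : comNzSemiRingType) (a b : semisub_ideal S) :
  (a : set S) `<=` b -> (b : set S) `<=` a -> a = b.
Proof.
case: a b => [A iA sA] [B iB sB] /= AB BA.
have eAB : A = B by apply/seteqP; split.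
rewrite -{}eAB {AB BA B} in iB sB *.
by rewrite (Prop_irrelevance iA iB) (Prop_irrelevance sA sB).
Qed.

Lemma open_hullC (S : comNzSemiRingType) (a : semisub_ideal S) :
  open (~` hull a).
Proof.
(* Open sets are unions of finite intersections of subbasic sets; here a union
   and an intersection each indexed by a single set. *)
exists [set ~` hull a]; last by rewrite bigcup_set1.
by move=> _ ->; apply: (finI_from1 id); exists a.
Qed.

Lemma nbhs_hullC (S : comNzSemiRingType) (a b : semisub_ideal S) :
  ~ ((a : set S) `<=` b) -> nbhs b (~` hull a).
Proof. by move=> nab; apply: open_nbhs_nbhs; split; first exact: open_hullC. Qed.

Theorem proposition2p23 (S : comNzSemiRingType) :
  @kolmogorov_space (semisub_ideal S).
Proof.
move=> a b /eqP neq_ab.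
have notin_hullC (c : semisub_ideal S) : c \in ~` (~` hull c).
  by rewrite setCK inE; apply: subset_refl.
have [ab|nab] := pselect ((a : set S) `<=` b).
- exists (~` hull b); left; split=> //; rewrite inE; apply: nbhs_hullC => ba.
  exact/neq_ab/semisub_ideal_anti.
- by exists (~` hull a); right; split=> //; rewrite inE; apply: nbhs_hullC.
Qed.
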